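(* Let $F$ be a field, let $A$ be a finite-dimensional central simple $F$-algebra, and let $\theta$ be an involution (of the first kind) on $A$. Put $\varepsilon=\varepsilon(\theta)\in\{\pm1\}$. Then for every $a\in A$ there exists $g\in A^\times$ such that \[ g a g^{-1} = {}^{\theta}a \quad\text{and}\quad {}^{\theta}g=\varepsilon\, g . \]
   Context: An involution (of the first kind) on $A$ is a map $\theta:A\to A$, written $a\mapsto {}^{\theta}a$, which is $F$-linear, satisfies ${}^{\theta}(ab)={}^{\theta}b\,{}^{\theta}a$ for all $a,b\in A$, and ${}^{\theta}({}^{\theta}a)=a$ for all $a$. The sign $\varepsilon(\theta)$ is defined as follows. First, for an involution $\theta'$ of $\mathrm{M}_n(K)$ ($K$ a field), there is $b\in \mathrm{GL}_n(K)$, unique up to a nonzero scalar, with ${}^{\theta'}a=b\,({}^{\top}a)\,b^{-1}$ for all $a$, where ${}^\top$ denotes transpose; then ${}^{\top}b=\varepsilon b$ for a sign $\varepsilon=\pm1$, and one sets $\varepsilon(\theta')=\varepsilon$. In general, let $\bar F$ be an algebraic closure of $F$, $\bar A=A\otimes_F\bar F\cong \mathrm{M}_n(\bar F)$ with $n^2=\dim_F A$, and $\bar\theta=\theta\otimes 1_{\bar F}$; then $\varepsilon(\theta):=\varepsilon(\alpha\bar\theta\alpha^{-1})$ for any $\bar F$-algebra isomorphism $\alpha:\bar A\to\mathrm{M}_n(\bar F)$ (independent of choices). *)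

(* Defs.v *)
From HB Require Import structures.
From mathcomp Require Import all_boot all_order all_algebra all_field.
Set Implicit Arguments. Unset Strict Implicit. Unset Printing Implicit Defensive.
Import GRing.Theory.
Local Open Scope ring_scope.

Definition is_central (F : fieldType) (A : falgType F) : Prop :=
  forall x : A, (forall y : A, x * y = y * x) -> exists c : F, x = c%:A.

(* Simple: the only two-sided ideals are 0 and A (A <> 0 holds since falgType
   is a non-trivial ring).  Two-sided ideals are F-subspaces automatically. *)
Definition is_simple (F : fieldType) (A : falgType F) : Prop :=
  forall I : {vspace A},
    (forall a x : A, x \in I -> (a * x \in I) /\ (x * a \in I)) ->
    I = 0%VS \/ I = fullv.

Definition is_csa (F : fieldType) (A : falgType F) : Prop :=
  is_central A /\ is_simple A.

Definition is_involution (F : fieldType) (A : falgType F) (th : A -> A) : Prop :=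
  [/\ forall (c : F) (x y : A), th (c *: x + y) = c *: th x + th y,
      forall x y : A, th (x * y) = th y * th x
    & forall x : A, th (th x) = x].

(* The sign of an involution.  [inv_sign th e] says eps(th) = e.
   An L-algebra isomorphism alpha : A (x)_F L -> M_n(L) is encoded by its
   restriction phi := alpha(- (x) 1) : A -> M_n(L), which is iota-semilinear,
   unital and multiplicative, and whose values on an F-basis of A are
   L-linearly independent, with dim_F A = n^2 (so that the L-linear extension
   is bijective).  The conjugated involution alpha thetabar alpha^-1 is
   a |-> b a^T b^-1 iff phi (th x) = b phi(x)^T b^-1 for all x in A
   (both sides being L-linear in the first tensor factor). *)
Definition inv_sign (F : fieldType) (A : falgType F) (th : A -> A) (e : F) : Prop :=
  exists (L : fieldType) (iota : {rmorphism F -> L}) (n : nat)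
         (phi : A -> 'M[L]_n) (b : 'M[L]_n),
    (forall (c : F) (x y : A), phi (c *: x + y) = iota c *: phi x + phi y) /\
    phi 1 = 1%:M /\
    (forall x y : A, phi (x * y) = phi x *m phi y) /\
    \dim (fullv : {vspace A}) = (n * n)%N /\
    (forall c : 'I_(\dim (fullv : {vspace A})) -> L,
        \sum_i c i *: phi ((vbasis (fullv : {vspace A}))`_i) = 0 ->
        forall i, c i = 0) /\
    b \in unitmx /\
    (forall x : A, phi (th x) = b *m (phi x)^T *m invmx b) /\
    b^T = iota e *: b.

(* Main.v *)
Require Import Defs.
From HB Require Import structures.
From mathcomp Require Import all_boot all_order all_algebra all_field.
From mathcomp Require Import zify.
From Stdlib Require Import Classical.
Import GRing.Theory.
Local Open Scope ring_scope.
Set Implicit Arguments. Unset Strict Implicit. Unset Printing Implicit Defensive.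

(** Over the splitting field L, the equation a g = g th(a) together with
th(g) = e g becomes, after the substitution G = S b^-1, the problem of finding
a symmetric invertible S with X S = S X^T for X the image of a.  Such an S
exists for every square matrix over every field (Taussky-Zassenhaus): splitting
off coprime kernels and cyclic summands reduces to a cyclic X, where the Hankel
form (u, w) |-> f(u w) on K[X]/(m) is symmetric, nondegenerate and makes X
self-adjoint.

To descend to F, note that the g in A solving the linear equations form an
F-subspace whose L-span is the space of all solutions G over L.  If F is
infinite, a nonvanishing determinant on the span is nonvanishing at some
F-point.  If F is finite, take an element of A of minimal rank in the
representation; a power of a suitable multiple is an idempotent u of the same
rank, u A u is a finite domain, hence commutative by Wedderburn, and therefore
u has rank one.  Then A acts on A u over F, and the theorem on symmetric
intertwiners applied over F itself gives g as a combination of the elements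
w_i y th(w_j), for w a basis of A u.

The theorem is obtained from a solution for th(a) in place of a. *)

(** * Symmetric intertwiners of a matrix and its transpose *)

Section SymmetricIntertwiner.
Variable K : fieldType.

Definition has_sym_intertwiner n (X : 'M[K]_n) :=
  exists H : 'M[K]_n, [/\ H \in unitmx, H^T = H & X *m H = H *m X^T].

(** The rows of [P1] and [P2] are bases of complementary [X]-stable subspaces of row vectors.
    Passing from the block form back to [X] acts on intertwiners by the congruence [H] to
    [P^-1 H P^-T], which keeps symmetry. *)
Lemma sym_intertwiner_glue n n1 n2 (X : 'M[K]_n) (P1 : 'M_(n1, n))
    (P2 : 'M_(n2, n)) X1 X2 :
  (n1 + n2 = n)%N -> row_free (col_mx P1 P2) ->
  P1 *m X = X1 *m P1 -> P2 *m X = X2 *m P2 ->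
  has_sym_intertwiner X1 -> has_sym_intertwiner X2 -> has_sym_intertwiner X.
Proof.
move=> en; case: n / en X P1 P2 => X P1 P2.
move=> freeP eX1 eX2 [H1 [uH1 sH1 cH1]] [H2 [uH2 sH2 cH2]].
set P := col_mx P1 P2 in freeP; set Y := block_mx X1 0 0 X2.
have uP : P \in unitmx by rewrite -row_free_unit.
have ePX : P *m X = Y *m P.
  by rewrite mul_col_mx eX1 eX2 mul_block_col !mul0mx addr0 add0r.
have eXP : X *m invmx P = invmx P *m Y.
  by rewrite -[X](mulKmx uP) ePX !mulmxA mulmxK.
set H := block_mx H1 0 0 H2.
have cH : Y *m H = H *m Y^T.
  by rewrite tr_block_mx !mulmx_block !trmx0 !(mulmx0, mul0mx, addr0, add0r) cH1 cH2.
exists (invmx P *m H *m (invmx P)^T); split.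
- have uH : H \in unitmx.
    by rewrite unitmxE det_ublock unitrM -!unitmxE uH1 uH2.
  by rewrite !unitmx_mul uH unitmx_tr unitmx_inv uP.
- by rewrite !trmx_mul trmxK tr_block_mx !trmx0 sH1 sH2 mulmxA.
- by rewrite !mulmxA eXP -(mulmxA _ Y) cH -!mulmxA -!trmx_mul eXP.
Qed.

(** * Cyclic vectors and coprime kernels *)

Lemma poly_power_cofactor (p r : {poly K}) : (1 < size p)%N -> r != 0 ->
  exists j s, r = p ^+ j * s /\ ~~ (p %| s).
Proof.
move=> p1; have [m] := ubnP (size r); elim: m r => // m IH r; rewrite ltnS => lrm r0.
have [/dvdpP [q er]|npr] := boolP (p %| r); last by exists 0, r; rewrite mul1r.
have q0 : q != 0 by apply: contraNneq r0 => q0; rewrite er q0 mul0r.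
have p0 : p != 0 by rewrite -size_poly_gt0 ltnW.
have /IH /(_ q0) [j [s [eq nps]]] : (size q < m)%N.
  have : size r = (size q + size p).-1 by rewrite er size_mul.
  have : (0 < size q)%N by rewrite size_poly_gt0.
  lia.
by exists j.+1, s; split=> //; rewrite er eq exprSr mulrAC.
Qed.

Lemma ker_coprime_horner_mx m n (X : 'M[K]_n.+1) (B : 'M_(m, n.+1)) p q :
  coprimep p q -> B *m horner_mx X p = 0 -> B *m horner_mx X q = 0 -> B = 0.
Proof.
case/Bezout_eq1_coprimepP => -[u v] /= e1 Bp Bq.
rewrite -[B]mulmx1 -[1%:M](rmorph1 (horner_mx X)) -e1 rmorphD !rmorphM /=.
rewrite (comm_horner_mx2 X u) (comm_horner_mx2 X v) mulmxDr.
by rewrite -!mulmxE !mulmxA Bp Bq !mul0mx addr0.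
Qed.

Lemma horner_mx_coprime_unit n (X : 'M[K]_n.+1) p q :
  coprimep p q -> horner_mx X q = 0 -> horner_mx X p \in unitmx.
Proof.
move=> cpq q0; rewrite -row_free_unit -kermx_eq0; apply/eqP.
by apply: (ker_coprime_horner_mx cpq (mulmx_ker _)); rewrite q0 mulmx0.
Qed.

(** Such a [p] stands in for an irreducible factor of the minimal polynomial. The descent starts at
    the minimal polynomial, whose value 0 is singular. *)
Lemma minimal_singular_poly n (X : 'M[K]_n.+1) :
  exists p : {poly K}, [/\ p != 0, horner_mx X p \notin unitmx &
    forall q : {poly K}, q != 0 -> horner_mx X q \notin unitmx -> (size p <= size q)%N].
Proof.
have mm0 : mxminpoly X != 0 by rewrite monic_neq0 ?mxminpoly_monic.
have : horner_mx X (mxminpoly X) \notin unitmx.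
  by rewrite mx_root_minpoly unitmxE det0 ?unitr0.
move: (mxminpoly X) mm0 => q; have [m] := ubnP (size q).
elim: m q => // m IH q; rewrite ltnS => lqm q0 bq.
have [[r [r0 br lrq]]|H] := classic (exists r,
  [/\ r != 0, horner_mx X r \notin unitmx & (size r < size q)%N]).
  by apply: (IH r) => //; apply: leq_trans lqm.
exists q; split=> // r r0 br; rewrite leqNgt; apply/negP => lrq.
by apply: H; exists r.
Qed.

(** A nontrivial gcd would split [p] into two factors of smaller degree. Both would be invertible at
    [X] by minimality, hence so would [p]. *)
Lemma minimal_singular_poly_coprime n (X : 'M[K]_n.+1) (p s : {poly K}) :
  p != 0 -> horner_mx X p \notin unitmx ->
  (forall q : {poly K}, q != 0 -> horner_mx X q \notin unitmx -> (size p <= size q)%N) ->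
  ~~ (p %| s) -> coprimep p s.
Proof.
move=> p0 bp minp nps; set g := gcdp p s.
have gp : g %| p by apply: dvdp_gcdl.
have g0 : g != 0 by apply: contraNneq p0 => g0; rewrite g0 dvd0p in gp.
have lgp : (size g < size p)%N.
  rewrite ltn_neqAle dvdp_leq // andbT (dvdp_size_eqp gp).
  by apply: contra nps => /andP[_ /dvdp_trans]; apply; apply: dvdp_gcdr.
rewrite /coprimep; apply/negPn/negP => g1.
have {}g1 : (1 < size g)%N by rewrite ltn_neqAle eq_sym g1 size_poly_gt0.
have [h eh] : exists h : {poly K}, p = h * g by apply/dvdpP.
have h0 : h != 0 by apply: contraNneq p0 => h0; rewrite eh h0 mul0r.
have lhp : (size h < size p)%N.
  by rewrite eh size_mul // -(ltn_predK g1) addnS /= -[ltnLHS]addn0 ltn_add2l -ltnS (ltn_predK g1).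
have good (q : {poly K}) : q != 0 -> (size q < size p)%N -> horner_mx X q \in unitmx.
  by move=> q0 lq; apply/negPn/negP => /(minp q q0); rewrite leqNgt lq.
by move: bp; rewrite eh rmorphM /= unitmx_mul !good.
Qed.

(** Write the minimal polynomial as [p ^+ j * s] with [p] prime to [s]. If [s] is singular at [X],
    these two factors are the coprime pair; otherwise a power of [p] annihilates [X], and a vector
    surviving the last nonzero power has the full annihilator. *)
Lemma cyclic_or_coprime_kernels n (X : 'M[K]_n.+1) :
  (exists v : 'rV_n.+1, forall r, v *m horner_mx X r = 0 -> horner_mx X r = 0) \/
  exists p s : {poly K}, [/\ coprimep p s, horner_mx X p \notin unitmx,
    horner_mx X s \notin unitmx & horner_mx X (p * s) = 0].
Proof.
have [p [p0 bp minp]] := minimal_singular_poly X.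
have p1 : (1 < size p)%N.
  rewrite ltnNge; apply: contra bp => /size1_polyC ep.
  rewrite ep horner_mx_C unitmxE det_scalar unitrX // unitfE.
  by apply: contraNneq p0 => c0; rewrite ep c0.
have cop (s : {poly K}) : ~~ (p %| s) -> coprimep p s by exact: (minimal_singular_poly_coprime p0 bp minp).
have mm0 : mxminpoly X != 0 by rewrite monic_neq0 ?mxminpoly_monic.
have [j [s [emm nps]]] := poly_power_cofactor p1 mm0.
have mmX := mx_root_minpoly X; rewrite emm in mmX.
have [gs|bs] := boolP (horner_mx X s \in unitmx); last first.
  right; exists (p ^+ j), s; split=> //; first by rewrite coprimep_expl ?cop.
  (* For j = 0 the polynomial [s] annihilates [X], so [p], being coprime to it, would be invertible
     at [X]. *)
  case: j {emm} mmX => [|j] mmX; last by rewrite rmorphXn exprS unitmx_mul (negPf bp).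
  by case/negP: bp; apply: horner_mx_coprime_unit (cop _ nps) _; rewrite mul1r in mmX.
left.
have exk : exists k, horner_mx X (p ^+ k) == 0.
  exists j; move: mmX; rewrite rmorphM /= => /(congr1 (mulmx^~ (invmx (horner_mx X s)))).
  by rewrite mulmxK // mul0mx => ->.
case: (ex_minnP exk) => k /eqP pk0 mink.
case: k => [|k] in pk0 mink.
  by move/eqP: pk0; rewrite rmorph1 oner_eq0.
have /rowV0Pn [w wle w0] : horner_mx X (p ^+ k) != 0.
  by apply/negP => /mink; rewrite ltnn.
have /submxP [v ew] := wle; exists v => r vr.
have [->|r0] := eqVneq r 0; first by rewrite rmorph0.
have [i [t [er npt]]] := poly_power_cofactor p1 r0.
have [lki|lik] := ltnP k i.
  by rewrite er -(subnKC lki) exprD -mulrA rmorphM /= pk0 mul0r.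
(* Now i <= k, and [w] is killed by p(X) and also by t(X), because w t(X) = v r(X) p^(k-i)(X). *)
case/eqP: w0; apply: (ker_coprime_horner_mx (X := X) (cop _ npt)).
  by move: pk0; rewrite exprSr (rmorphM (horner_mx X)) -mulmxE ew -mulmxA => ->; rewrite mulmx0.
have epk : p ^+ k * t = r * p ^+ (k - i) by rewrite er mulrAC -exprD subnKC.
have : horner_mx X (p ^+ k * t) = horner_mx X (r * p ^+ (k - i)) by rewrite epk.
by rewrite !rmorphM -!mulmxE ew -mulmxA => ->; rewrite mulmxA vr mul0mx.
Qed.

(** * The Hankel form on a cyclic subspace *)

Lemma horner_mx_mod_minpoly n (X : 'M[K]_n.+1) r :
  exists c : 'rV_(degree_mxminpoly X),
    horner_mx X r = horner_mx X (rVpoly c).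
Proof.
exists (poly_rV (r %% mxminpoly X)); rewrite poly_rV_K ?size_mod_mxminpoly //.
rewrite {1}(divp_eq r (mxminpoly X)) rmorphD rmorphM /= mx_root_minpoly.
by rewrite mulr0 add0r.
Qed.

Lemma horner_mx_rVpoly_sum n (X : 'M[K]_n.+1) d (c : 'rV_d) :
  horner_mx X (rVpoly c) = \sum_i c 0 i *: X ^+ i.
Proof.
rewrite [rVpoly c]poly_def linear_sum; apply: eq_bigr => i _.
by rewrite linearZ /= rmorphXn /= horner_mx_X valK.
Qed.

(** The rows v X^i of [B] span a cyclic subspace, and the columns X^j f of [C] pair with them in an
    invertible Hankel matrix [h]. Hence [kermx C] is a complement; it is [X]-stable and smaller, so
    [IH] handles it, while [h] serves on the cyclic part. *)
Lemma sym_intertwiner_cyclic_split n (X : 'M[K]_n.+1) (v : 'rV_n.+1) :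
  (forall r, v *m horner_mx X r = 0 -> horner_mx X r = 0) ->
  (forall m (Y : 'M[K]_m), (m < n.+1)%N -> has_sym_intertwiner Y) ->
  has_sym_intertwiner X.
Proof.
move=> annv IH; set d := degree_mxminpoly X.
have dgt0 : (0 < d)%N by apply: mxminpoly_nonconstant.
have sz_r0 (r : {poly K}) : (size r <= d)%N -> v *m horner_mx X r = 0 -> r = 0.
  move=> szr /annv /mxminpoly_min; apply: contraTeq => r0.
  by apply: contraL szr => /(dvdp_leq r0); rewrite size_mxminpoly -ltnNge.
pose B := \matrix_(i < d) (v *m X ^+ i).
have cB (c : 'rV_d) : c *m B = v *m horner_mx X (rVpoly c).
  rewrite horner_mx_rVpoly_sum mulmx_sumr mulmx_sum_row; apply: eq_bigr => i _.
  by rewrite rowK scalemxAr.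
have freeB : row_free B.
  apply: inj_row_free => c; rewrite cB => /sz_r0 c0.
  by rewrite -[c]rVpolyK c0 ?size_poly // linear0.
have /row_freeP [B' BB'] := freeB.
(* [l] is the index d - 1, and [f] is a functional reading off the coefficient of degree d - 1 of
   [r] from v r(X). *)
pose l : 'I_d := Ordinal (etrans (f_equal (leq^~ d) (prednK dgt0)) (leqnn d)).
pose f := B' *m (delta_mx l 0 : 'cV_d).
have tauE (r : {poly K}) : (size r <= d)%N ->
    v *m horner_mx X r *m f = (r`_d.-1)%:M.
  move=> szr; rewrite -{1}(poly_rV_K szr) -cB /f mulmxA -(mulmxA _ B) BB' mulmx1.
  by apply/matrixP=> i j; rewrite !ord1 -colE !mxE mulr1n.
have hXn k : X ^+ k = horner_mx X 'X^k by rewrite rmorphXn /= horner_mx_X.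
have mulhh m (u : 'M_(m, n.+1)) (r s : {poly K}) :
    u *m horner_mx X r *m horner_mx X s = u *m horner_mx X (r * s).
  by rewrite -mulmxA mulmxE -(rmorphM (horner_mx X)).
pose C := \matrix_(i < n.+1, j < d) (X ^+ j *m f) i 0.
have colC (u : 'rV_n.+1) j : (u *m C) 0 j = (u *m X ^+ j *m f) 0 0.
  by rewrite -mulmxA !mxE; apply: eq_bigr => k _; rewrite !mxE.
pose h := B *m C.
have uh : h \in unitmx.
  rewrite -row_free_unit; apply: inj_row_free => c; rewrite /h mulmxA cB => ch0.
  set r := rVpoly c in ch0; have szr : (size r <= d)%N by apply: size_poly.
  suff r0 : r = 0 by rewrite -[c]rVpolyK -/r r0 linear0.
  apply/eqP/negPn/negP => r0.
  have szr0 : (0 < size r)%N by rewrite size_poly_gt0.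
  (* Multiplying by X^(d - size r) moves the leading coefficient of [r] to degree d - 1, where [f]
     sees it. *)
  have jP : (d - size r < d)%N by rewrite ltn_subrL szr0.
  have := colC (v *m horner_mx X r) (Ordinal jP).
  rewrite ch0 mxE /= hXn mulhh.
  have szrj : (size (r * 'X^(d - size r) : {poly K})%R <= d)%N.
    by rewrite size_mulXn // subnK.
  rewrite (tauE _ szrj) mxE mulr1n coefMXn ifF; last by move: szr0 szr; move: (size r) => m ? ?; lia.
  have -> : (d.-1 - (d - size r) = (size r).-1)%N.
    by move: szr0 szr; move: (size r) => m ? ?; lia.
  by move/esym/eqP; rewrite -lead_coefE lead_coef_eq0 (negPf r0).
have hsym : h^T = h.
  apply/matrixP=> i j; rewrite mxE /h.
  have rowB k : row k B = v *m horner_mx X 'X^k by rewrite rowK hXn.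
  have hE k k' : (B *m C) k k' = (v *m horner_mx X ('X^k * 'X^k') *m f) 0 0.
    have := colC (row k B) k'; rewrite -row_mul mxE => ->.
    by rewrite rowB hXn mulhh.
  by rewrite !hE mulrC.
have stB : (B *m X <= B)%MS.
  apply/row_subP => i; rewrite row_mul rowK hXn -{2}[X](horner_mx_X X) mulhh.
  have [c ->] := horner_mx_mod_minpoly X ('X^i * 'X).
  by rewrite -cB submxMl.
have stC : (kermx C *m X <= kermx C)%MS.
  apply/sub_kermxP/row_matrixP=> i; rewrite row0.
  set u := row i (kermx C).
  have uC : u *m C = 0 by rewrite /u -row_mul mulmx_ker row0.
  apply/rowP=> j; rewrite -mulmxA row_mul mulmxA -/u colC.
  (* The vanishing of u X^j f for j < d extends to all polynomials by reduction modulo the minimal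
     polynomial. *)
  have hC (r : {poly K}) : u *m horner_mx X r *m f = 0.
    have [c ->] := horner_mx_mod_minpoly X r.
    rewrite horner_mx_rVpoly_sum mulmx_sumr mulmx_suml big1 // => k _.
    rewrite -scalemxAr -scalemxAl; apply/matrixP=> a b; rewrite !ord1 mxE -colC uC.
    by rewrite !mxE mulr0.
  by rewrite -{1}(horner_mx_X X) hXn mulhh hC !mxE.
have /submxP [X1 eX1] := stB.
have /submxP [X2 eX2] : (row_base (kermx C) *m X <= row_base (kermx C))%MS.
  by rewrite stablemx_row_base.
have rC : \rank C = d.
  apply/eqP; rewrite eqn_leq rank_leq_col /=.
  by rewrite -{1}(mxrank_unit uh) mxrankS // submxMl.
have dn : (d <= n.+1)%N by rewrite -rC rank_leq_row.
have szs : (d + \rank (kermx C) = n.+1)%N by rewrite mxrank_ker rC subnKC.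
apply: (sym_intertwiner_glue szs _ eX1 eX2).
- apply: inj_row_free => c; rewrite -[c]hsubmxK mul_row_col => c0.
  have KC : row_base (kermx C) *m C = 0.
    by apply/sub_kermxP; rewrite eq_row_base.
  have c1 : lsubmx c = 0.
    have := congr1 (mulmx^~ C) c0; rewrite /= mulmxDl -(mulmxA (rsubmx c)) KC mulmx0 addr0 mul0mx -mulmxA -/h.
    by move/(congr1 (mulmx^~ (invmx h))); rewrite mulmxK // mul0mx.
  rewrite c1 mul0mx add0r in c0 *.
  by rewrite (row_free_inj (row_base_free _) (etrans c0 (esym (mul0mx _ _)))) row_mx0.
- exists h; split=> //.
  (* The entries of [X1 *m h] are v X^(i+j+1) f, symmetric in i and j. *)
  have e1 : X1 *m h = B *m X *m C by rewrite /h mulmxA -eX1.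
  have -> : h *m X1^T = (X1 *m h)^T by rewrite trmx_mul hsym.
  rewrite e1; apply/matrixP=> i j; rewrite [RHS]mxE.
  have hE k k' : (B *m X *m C) k k' = (v *m horner_mx X ('X^k * 'X * 'X^k') *m f) 0 0.
    have := colC (row k (B *m X)) k'; rewrite -row_mul mxE => ->.
    by rewrite row_mul rowK hXn -{2}[X](horner_mx_X X) !mulhh hXn mulhh.
  by rewrite !hE [_ * 'X^j]mulrC mulrA mulrAC.
- by apply: IH; rewrite -[ltnRHS]szs -[ltnLHS]add0n ltn_add2r.
Qed.

Theorem sym_intertwiner n (X : 'M[K]_n) : has_sym_intertwiner X.
Proof.
have [m] := ubnP n; elim: m n X => // m IH [|n] X lnm.
  by exists 1%:M; rewrite unitmx1 trmx1; split=> //; apply/matrixP=> -[].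
have {}IH k (Y : 'M[K]_k) : (k < n.+1)%N -> has_sym_intertwiner Y.
  by move=> lkn; apply: IH; apply: leq_trans lkn _.
have [[v annv]|[p [s [cps bp bs ps0]]]] := cyclic_or_coprime_kernels X.
  exact: sym_intertwiner_cyclic_split annv IH.
pose U := kermxpoly X p; pose W := kermxpoly X s.
have UW : (U + W :=: 1%:M)%MS.
  apply: eqmx_trans (eqmx_sym (kermxpolyM X cps)) _.
  by rewrite /kermxpoly ps0; apply: kermx0.
have szUW : (\rank U + \rank W = n.+1)%N.
  by rewrite -mxrank_sum_cap mxdirect_kermxpoly // UW mxrank1 mxrank0 addn0.
have rk_gt0 q : horner_mx X q \notin unitmx -> (0 < \rank (kermxpoly X q))%N.
  by rewrite lt0n mxrank_eq0 kermx_eq0 row_free_unit.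
have U0 := rk_gt0 p bp; have W0 := rk_gt0 s bs.
have stab q : exists Y, row_base (kermxpoly X q) *m X = Y *m row_base (kermxpoly X q).
  by apply/submxP; rewrite stablemx_row_base comm_mx_stable_kermxpoly.
have [X1 eX1] := stab p; have [X2 eX2] := stab s.
apply: (sym_intertwiner_glue szUW _ eX1 eX2).
- rewrite /row_free -addsmxE (adds_eqmx (eq_row_base _) (eq_row_base _)) UW.
  by rewrite mxrank1 szUW.
- by apply: IH; rewrite -[ltnRHS]szUW -[ltnLHS]addn0 ltn_add2l.
- by apply: IH; rewrite -[ltnRHS]szUW -[ltnLHS]add0n ltn_add2r.
Qed.
End SymmetricIntertwiner.

(** * Finite domains and rank one corners *)

(** The enumeration equips [R] with a finite ring structure, to which Wedderburn's little theorem
    applies. *)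
Lemma enumerated_domain_mulrC (R : unitRingType) (l : seq R) :
  (forall x, x \in l) -> GRing.integral_domain_axiom R -> commutative (@GRing.mul R).
Proof.
move=> lP domR.
have pcanR : pcancel (index^~ (undup l)) (onth (undup l)).
  by move=> x; rewrite onthE (nth_map x) ?nth_index ?index_mem ?mem_undup.
pose R1 : countType := HB.pack (GRing.UnitRing.sort R) (PCanIsCountable pcanR).
have finR : Finite.axiom (undup l : seq R1).
  by move=> x; rewrite count_uniq_mem ?undup_uniq // mem_undup lP.
pose R2 : finUnitRingType :=
  HB.pack (GRing.UnitRing.sort R) (PCanIsCountable pcanR) (isFinite.Build R1 finR).
exact: (@finDomain_mulrC R2 domR).
Qed.

Lemma finite_vect_enumeration (F : fieldType) (V : vectType F) (s : seq F) :
  (forall c, c \in s) -> exists l : seq V, forall x, x \in l.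
Proof.
move=> sP.
suff H k (w : 'I_k -> V) : exists l : seq V, forall c : 'I_k -> F,
    \sum_i c i *: w i \in l.
  have [l lP] := H (\dim (fullv : {vspace V})) (fun i => (vbasis fullv)`_i).
  by exists l => x; rewrite (coord_vbasis (memvf x)).
elim: k w => [|k IH] w; first by exists [:: 0] => c; rewrite big_ord0 inE.
have [l lP] := IH (fun i => w (lift ord0 i)).
exists [seq c *: w ord0 + x | c <- s, x <- l] => c.
by rewrite big_ord_recl; apply: allpairs_f; [apply: sP | apply: (lP (fun i => c (lift ord0 i)))].
Qed.

Lemma pow_idempotent (R : nzRingType) (l : seq R) (z : R) :
  (forall x, x \in l) -> exists m, z ^+ m.+1 * z ^+ m.+1 = z ^+ m.+1.
Proof.
move=> lP; pose t := [seq z ^+ k | k <- iota 0 (size l).+1].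
have nut : ~~ uniq t.
  apply/negP => /uniq_leq_size /(_ (fun x _ => lP x)).
  by rewrite size_map size_iota ltnn.
have /(uniqPn 0) [i [j [lij ljt]]] := nut; rewrite size_map size_iota in ljt.
have lit := ltn_trans lij ljt.
rewrite !(nth_map 0) ?size_iota // !nth_iota // !add0n => ez.
pose p := (j - i)%N; have p0 : (0 < p)%N by rewrite subn_gt0.
have per q : (i <= q)%N -> z ^+ (q + p) = z ^+ q.
  by move=> liq; rewrite -(subnK liq) -addnA exprD [RHS]exprD /p subnKC ?(ltnW lij) // ez.
have pert q r : (i <= q)%N -> z ^+ (q + r * p) = z ^+ q.
  move=> liq; elim: r => [|r IH]; first by rewrite addn0.
  by rewrite mulSn addnCA addnC per ?IH // (leq_trans liq) ?leq_addr.
have m0 : (0 < i.+1 * p)%N by rewrite muln_gt0.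
(* The exponent (i+1)p is positive, lies in the periodic range and is a multiple of the period, so
   doubling it does not change the power. *)
exists (i.+1 * p).-1; rewrite prednK // -exprD pert //.
by rewrite (leq_trans (leqnSn i)) // leq_pmulr.
Qed.

Section RankOne.
Variable L : fieldType.

(** Factoring [E = C *m R] with [R *m C = 1%:M] identifies the corner with the r by r matrices
    through [C *m Y *m R]. These commute only for r = 1, as two matrix units show. *)
Lemma commuting_corner_rank1 n (E : 'M[L]_n) :
  E != 0 -> E *m E = E ->
  (forall X Y, E *m X *m E *m Y *m E = E *m Y *m E *m X *m E) ->
  exists (p : 'cV[L]_n) (q : 'rV[L]_n), E = p *m q /\ q *m p = 1%:M.
Proof.
move=> E0 EE comE; set r := \rank E.
have [C [R [eE RC]]] : exists (C : 'M[L]_(n, r)) (R : 'M_(r, n)),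
    E = C *m R /\ R *m C = 1%:M.
  have [C [R [eE fC fR]]] : exists (C : 'M[L]_(n, r)) (R : 'M_(r, n)),
      [/\ E = C *m R, row_full C & row_free R].
    exists (col_base E), (row_base E).
    by rewrite mulmx_base col_base_full row_base_free.
  exists C, R; split=> //.
  have /row_freeP [R' RR'] := fR; have /row_fullP [C' CC'] := fC.
  move: EE; rewrite eE => /(congr1 (fun Z => C' *m Z *m R')).
  by rewrite !mulmxA CC' mul1mx -!mulmxA RR' mulmx1.
have r0 : (0 < r)%N by rewrite lt0n mxrank_eq0.
have comr (Y Z : 'M[L]_r) : Y *m Z = Z *m Y.
  have := comE (C *m Y *m R) (C *m Z *m R).
  have red (Y1 Y2 : 'M[L]_r) :
      E *m (C *m Y1 *m R) *m E *m (C *m Y2 *m R) *m E = C *m (Y1 *m Y2) *m R.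
    by rewrite eE !mulmxA -!(mulmxA _ R C) !RC !mulmx1.
  rewrite !red => /(congr1 (fun Z => R *m Z *m C)).
  by rewrite !mulmxA RC !mul1mx -!(mulmxA _ R C) RC !mulmx1.
have r1 : r = 1%N.
  apply/eqP; rewrite eqn_leq r0 andbT leqNgt; apply/negP => lr1.
  pose i := Ordinal r0; pose j := Ordinal lr1.
  have := comr (delta_mx i j) (delta_mx j i); rewrite !mul_delta_mx.
  move/matrixP/(_ i i); rewrite !mxE !eqxx /= => /eqP.
  by rewrite oner_eq0.
by rewrite r1 in C R eE RC; exists C, R.
Qed.
End RankOne.

(** * Determinants over infinite fields *)

Lemma semilinear_sum (K K' : nzRingType) (V : lmodType K) (W : lmodType K')
    (s : {rmorphism K -> K'}) (h : V -> W) :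
  (forall c x y, h (c *: x + y) = s c *: h x + h y) ->
  forall k (c : 'I_k -> K) (x : 'I_k -> V),
  h (\sum_i c i *: x i) = \sum_i s (c i) *: h (x i).
Proof.
move=> hl k c x; have h0 : h 0 = 0.
  apply: (addrI (h 0)); rewrite addr0.
  by have := hl 1 0 0; rewrite rmorph1 !scale1r addr0.
elim: k c x => [|k IH] c x; first by rewrite !big_ord0.
by rewrite !big_ord_recl hl IH.
Qed.

Section InfiniteField.
Variables (F L : fieldType) (iota : {rmorphism F -> L}) (n : nat).
Hypothesis infF : forall m, exists s : seq F, uniq s /\ size s = m.

(** The determinant of B + T G is a polynomial in T, nonzero because of its value at [x]; its
    finitely many roots cannot exhaust [F]. *)
Lemma infinite_det_pencil (B G : 'M[L]_n) (x : L) :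
  \det (B + x *: G) != 0 -> exists t : F, \det (B + iota t *: G) != 0.
Proof.
pose p := \det (map_mx polyC B + 'X *: map_mx polyC G).
have pE y : p.[y] = \det (B + y *: G).
  rewrite -[p.[y]]/(horner_eval y p) /p -det_map_mx; congr (\det _).
  by apply/matrixP=> i j; rewrite !mxE [LHS]/= /horner_eval !hornerE.
move=> px; have p0 : p != 0.
  by apply: contraNneq px => p0; rewrite -pE p0 horner0.
have [s [us szs]] := infF (size p).
have : ~~ all (root p) (map iota s).
  apply/negP => rs; have := max_poly_roots p0 rs.
  by rewrite map_inj_uniq ?us //; [rewrite size_map szs ltnn => /(_ isT)|exact: fmorph_inj].
by case/allPn => _ /mapP [t _ ->]; rewrite /root pE => ?; exists t.
Qed.

Lemma infinite_det_span k (B : 'M[L]_n) (G : 'I_k -> 'M[L]_n) (d : 'I_k -> L) :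
  \det (B + \sum_i d i *: G i) != 0 ->
  exists t : 'I_k -> F, \det (B + \sum_i iota (t i) *: G i) != 0.
Proof.
elim: k B G d => [|k IH] B G d.
  by rewrite big_ord0 => B0; exists (fun=> 0); rewrite big_ord0.
rewrite big_ord_recl addrCA addrC => /infinite_det_pencil [t0].
rewrite addrAC => /IH [t tP].
exists (fun i => if unlift ord0 i is Some j then t j else t0).
rewrite big_ord_recl unlift_none addrA.
by under eq_bigr do rewrite liftK.
Qed.
End InfiniteField.

(** * Split representations and involutions *)

Section SplitRepresentation.
Variables (F : fieldType) (A : falgType F) (L : fieldType).
Variables (iota : {rmorphism F -> L}) (n : nat) (phi : A -> 'M[L]_n).
Hypothesis phi_lin :
  forall (c : F) (x y : A), phi (c *: x + y) = iota c *: phi x + phi y.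
Hypothesis phi1 : phi 1 = 1%:M.
Hypothesis phiM : forall x y : A, phi (x * y) = phi x *m phi y.
Hypothesis dimA : \dim (fullv : {vspace A}) = (n * n)%N.

Let N := \dim (fullv : {vspace A}).
Let X := vbasis (fullv : {vspace A}).

Hypothesis phi_free : forall c : 'I_N -> L,
  \sum_i c i *: phi X`_i = 0 -> forall i, c i = 0.

Let phi0 : phi 0 = 0.
Proof.
by have := semilinear_sum phi_lin (fun=> 0) (fun i : 'I_0 => X`_i); rewrite !big_ord0.
Qed.

Let phi_sum := semilinear_sum phi_lin.

Let phiZ c x : phi (c *: x) = iota c *: phi x.
Proof. by rewrite -[c *: x]addr0 phi_lin phi0 addr0. Qed.

Lemma rep_coordE x : phi x = \sum_i iota (coord X i x) *: phi X`_i.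
Proof. by rewrite -phi_sum -coord_vbasis // memvf. Qed.

Lemma rep_inj0 x : phi x = 0 -> x = 0.
Proof.
rewrite rep_coordE => /phi_free x0.
rewrite (coord_vbasis (memvf x)) big1 // => i _.
by move/eqP: (x0 i); rewrite fmorph_eq0 => /eqP ->; rewrite scale0r.
Qed.

Lemma rep_inj : injective phi.
Proof.
move=> x y exy; apply/eqP; rewrite -subr_eq0; apply/eqP/rep_inj0.
by rewrite addrC -scaleN1r phi_lin exy rmorphN1 scaleN1r addNr.
Qed.

Lemma rep_span G : exists c : 'I_N -> L, G = \sum_i c i *: phi X`_i.
Proof.
pose P : 'M[L]_(N, n * n) := \matrix_i mxvec (phi X`_i).
have cP (c : 'rV_N) : c *m P = mxvec (\sum_i c 0 i *: phi X`_i).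
  by rewrite mulmx_sum_row linear_sum; apply: eq_bigr => i _; rewrite rowK linearZ.
have freeP : row_free P.
  apply: inj_row_free => c; rewrite cP => /(congr1 vec_mx).
  by rewrite mxvecK linear0 => /phi_free c0; apply/rowP=> i; rewrite mxE c0.
have fullP : row_full P by rewrite /row_full (eqP freeP) /N dimA.
have /submxP [c ec] : (mxvec G <= P)%MS by apply: submx_full.
by exists (c 0); apply: (can_inj mxvecK); rewrite ec cP.
Qed.

Lemma rep_span_ind (P : 'M[L]_n -> Prop) :
  (forall x, P (phi x)) -> (forall c G1 G2, P G1 -> P G2 -> P (c *: G1 + G2)) ->
  forall G, P G.
Proof.
move=> Pphi Plin G; have [c ->] := rep_span G.
have P0 : P 0 by rewrite -phi0.
elim/big_rec: _ => [|i H _ PH]; [exact: P0 | exact: Plin].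
Qed.

Lemma rep_unit g : phi g \in unitmx -> g \is a GRing.unit.
Proof.
move=> ug; have ker0 : lker (amull g) == 0%VS.
  rewrite -subv0; apply/subvP=> y; rewrite memv_ker lfunE /= => /eqP gy.
  rewrite memv0; apply/eqP/rep_inj0.
  by rewrite -[phi y](mulKmx ug) -phiM gy phi0 mulmx0.
have /memv_imgP [h _] : 1 \in limg (amull g).
  suff /eqP -> : limg (amull g) == fullv by rewrite memvf.
  by rewrite eqEdim subvf limg_dim_eq ?(eqP ker0) ?capv0 /=.
rewrite lfunE /= => gh; apply/unitrP; exists h; split=> //.
apply: rep_inj; rewrite phiM phi1; apply: mulmx1C.
by rewrite -phiM -gh phi1.
Qed.

(** The coordinate matrix of a free family has full row rank, and rank is unchanged by the extension
    from [F] to [L]. *)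
Lemma rep_free k (w : k.-tuple A) (c : 'I_k -> L) :
  free w -> \sum_i c i *: phi w`_i = 0 -> forall i, c i = 0.
Proof.
move=> /freeP fw cw i; pose M : 'M[F]_(k, N) := \matrix_(i, j) coord X j w`_i.
have freeM : row_free M.
  apply: inj_row_free => a aM; apply/rowP=> j; rewrite mxE; apply: (fw (a 0)).
  under eq_bigr => i0 _ do rewrite (coord_vbasis (memvf w`_i0)) scaler_sumr.
  rewrite exchange_big big1 // => l _ /=.
  under eq_bigr => i0 _ do rewrite scalerA.
  rewrite -scaler_suml; move/rowP/(_ l): aM; rewrite !mxE.
  by under eq_bigr => i0 _ do rewrite !mxE; move=> ->; rewrite scale0r.
have : \row_i c i *m map_mx iota M = 0.
  apply/rowP=> l; rewrite !mxE.
  apply: (phi_free (c := fun l => \sum_j (\row_i c i) 0 j * (map_mx iota M) j l)).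
  rewrite -[RHS]cw; under eq_bigr => i0 _ do rewrite scaler_suml.
  rewrite exchange_big; apply: eq_bigr => j _; rewrite rep_coordE scaler_sumr.
  by apply: eq_bigr => l' _; rewrite !mxE scalerA.
move/eqP; rewrite mulmx_free_eq0 ?row_free_map // => /eqP/rowP/(_ i).
by rewrite !mxE.
Qed.

(** In the basis [X], the maps [g1] and [g2] have the matrices of [f1] and [f2] with entries sent to
    [L], and kernels commute with extension of scalars. *)
Lemma solution_space_extension (f1 f2 : A -> A) (g1 g2 : 'M[L]_n -> 'M[L]_n) G :
  (forall c x y, f1 (c *: x + y) = c *: f1 x + f1 y) ->
  (forall c x y, f2 (c *: x + y) = c *: f2 x + f2 y) ->
  (forall c x y, g1 (c *: x + y) = c *: g1 x + g1 y) ->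
  (forall c x y, g2 (c *: x + y) = c *: g2 x + g2 y) ->
  (forall x, phi (f1 x) = g1 (phi x)) -> (forall x, phi (f2 x) = g2 (phi x)) ->
  g1 G = 0 -> g2 G = 0 ->
  exists k (s : 'I_k -> A) (d : 'I_k -> L),
    (forall j, f1 (s j) = 0 /\ f2 (s j) = 0) /\ G = \sum_j d j *: phi (s j).
Proof.
move=> f1l f2l g1l g2l fg1 fg2 G1 G2.
pose M f := \matrix_(i < N, j < N) coord X j (f X`_i) : 'M[F]_N.
pose ev (a : 'rV[F]_N) := \sum_i a 0 i *: X`_i.
pose evL (c : 'rV[L]_N) := \sum_i c 0 i *: phi X`_i.
have evL0 c : evL c = 0 -> c = 0.
  by move/phi_free => c0; apply/rowP=> i; rewrite c0 mxE.
have phi_ev a : phi (ev a) = evL (map_mx iota a).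
  by rewrite /ev phi_sum; apply: eq_bigr => i _; rewrite mxE.
have fM f a : (forall c x y, f (c *: x + y) = c *: f x + f y) ->
    f (ev a) = ev (a *m M f).
  move=> fl; rewrite /ev (semilinear_sum (s := idfun) fl).
  under eq_bigr => i _ do rewrite (coord_vbasis (memvf (f X`_i))) scaler_sumr.
  rewrite exchange_big; apply: eq_bigr => j _ /=; rewrite !mxE scaler_suml.
  by apply: eq_bigr => i _; rewrite !mxE scalerA.
have gM f g c : (forall c x y, g (c *: x + y) = c *: g x + g y) ->
    (forall x, phi (f x) = g (phi x)) ->
    g (evL c) = evL (c *m map_mx iota (M f)).
  move=> gl fg; rewrite /evL (semilinear_sum (s := idfun) gl).
  under eq_bigr => i _ do rewrite -fg rep_coordE scaler_sumr.
  rewrite exchange_big; apply: eq_bigr => j _ /=; rewrite !mxE scaler_suml.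
  by apply: eq_bigr => i _; rewrite !mxE scalerA.
have [c eG] : exists c, G = evL c.
  have [c eG] := rep_span G; exists (\row_i c i); rewrite eG.
  by apply: eq_bigr => i _; rewrite mxE.
rewrite eG (gM _ _ _ g1l fg1) in G1; rewrite eG (gM _ _ _ g2l fg2) in G2.
pose M12 := row_mx (M f1) (M f2).
have cK : (c <= map_mx iota (kermx M12))%MS.
  rewrite map_kermx; apply/sub_kermxP.
  by rewrite map_row_mx mul_mx_row (evL0 _ G1) (evL0 _ G2) row_mx0.
have /submxP [d ed] := cK.
have := mulmx_ker M12; rewrite mul_mx_row => /eqP; rewrite row_mx_eq0.
case/andP=> /eqP K1 /eqP K2.
exists N, (fun j => ev (row j (kermx M12))), (d 0); split.
  move=> j; rewrite !fM // -!row_mul K1 K2 !row0.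
  by split; rewrite /ev big1 // => i _; rewrite mxE scale0r.
rewrite eG ed /evL mulmx_sum_row.
under [RHS]eq_bigr => j _ do rewrite phi_ev scaler_sumr.
rewrite exchange_big; apply: eq_bigr => i _ /=; rewrite summxE scaler_suml.
by apply: eq_bigr => j _; rewrite !mxE scalerA.
Qed.

(** * The involution, and descent over an infinite field *)

Variables (th : A -> A) (b : 'M[L]_n) (e : F).
Hypothesis thl : forall (c : F) (x y : A), th (c *: x + y) = c *: th x + th y.
Hypothesis ub : b \in unitmx.
Hypothesis phi_th : forall x, phi (th x) = b *m (phi x)^T *m invmx b.
Hypothesis symb : b^T = iota e *: b.

Let symbV : b *m invmx b^T = (iota e)%:M.
Proof. by rewrite -{1}[b]trmxK symb linearZ -scalemxAl -symb mulmxV ?unitmx_tr // scalemx1. Qed.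

Lemma conj_sym_div (S : 'M[L]_n) :
  S^T = S -> b *m (S *m invmx b)^T *m invmx b = iota e *: (S *m invmx b).
Proof.
by move=> sS; rewrite trmx_mul sS trmx_inv !mulmxA symbV mul_scalar_mx -scalemxAl.
Qed.

Lemma conj_div_intertwiner (S Y : 'M[L]_n) :
  Y *m S = S *m Y^T -> Y *m (S *m invmx b) = S *m invmx b *m (b *m Y^T *m invmx b).
Proof. by move=> cS; rewrite !mulmxA mulmxKV // cS. Qed.

Definition has_signed_intertwiner a := exists g : A,
  [/\ g \is a GRing.unit, a * g = g * th a & th g = e *: g].

Lemma infinite_signed_intertwiner a :
  (forall m, exists s : seq F, uniq s /\ size s = m) -> has_signed_intertwiner a.
Proof.
move=> infF; have [S [uS sS cS]] := sym_intertwiner (phi a).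
(* The common zeros of [f1] and [f2] are the solutions in [A]; [g1] and [g2] are the extensions to
   [L], with common zero [S *m invmx b]. *)
pose f1 g := a * g - g * th a; pose f2 g := th g - e *: g.
pose g1 G := phi a *m G - G *m phi (th a).
pose g2 G := b *m G^T *m invmx b - iota e *: G.
have phiB x y : phi (x - y) = phi x - phi y.
  by rewrite addrC -scaleN1r phi_lin rmorphN1 scaleN1r addrC.
have [k [s [d [sol eG]]]] : exists k (s : 'I_k -> A) (d : 'I_k -> L),
    (forall j, f1 (s j) = 0 /\ f2 (s j) = 0) /\
    S *m invmx b = \sum_j d j *: phi (s j).
  apply: (@solution_space_extension _ _ g1 g2).
  - move=> c x y; rewrite /f1 mulrDr mulrDl -scalerAr -scalerAl opprD.
    by rewrite scalerBr addrACA.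
  - by move=> c x y; rewrite /f2 thl scalerDr opprD addrACA scalerBr !scalerA mulrC.
  - move=> c x y; rewrite /g1 mulmxDr mulmxDl -scalemxAr -scalemxAl opprD.
    by rewrite scalerBr addrACA.
  - move=> c x y; rewrite /g2 linearP /= mulmxDr mulmxDl -scalemxAr -scalemxAl.
    by rewrite scalerDr opprD addrACA scalerBr !scalerA mulrC.
  - by move=> x; rewrite /f1 /g1 phiB !phiM.
  - by move=> x; rewrite /f2 /g2 phiB phi_th phiZ.
  - by rewrite /g1 phi_th conj_div_intertwiner // subrr.
  - by rewrite /g2 conj_sym_div // subrr.
have : \det (0 + \sum_j d j *: phi (s j)) != 0.
  by rewrite add0r -eG -unitfE -unitmxE unitmx_mul uS unitmx_inv ub.
case/(infinite_det_span iota infF) => t; rewrite add0r -phi_sum => ut.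
pose g := \sum_j t j *: s j; exists g; split.
- by apply: rep_unit; rewrite unitmxE unitfE.
- rewrite mulr_sumr mulr_suml; apply: eq_bigr => j _.
  have [/eqP] := sol j; rewrite subr_eq0 => /eqP ej _.
  by rewrite -scalerAr ej scalerAl.
- rewrite /g (semilinear_sum (s := idfun) thl) scaler_sumr; apply: eq_bigr => j _.
  have [_ /eqP] := sol j; rewrite subr_eq0 => /eqP ->.
  by rewrite !scalerA mulrC.
Qed.

(** * Elements of minimal rank, and the finite case *)

Let rk x := \rank (phi x).

Definition min_rank (x : A) := x != 0 /\ forall y : A, y != 0 -> (rk x <= rk y)%N.

Lemma min_rank_exists : exists x, min_rank x.
Proof.
have [m] := ubnP (rk 1); have : (1 : A) != 0 by apply: oner_neq0.
elim: m (1 : A) => // m IH x x0; rewrite ltnS => lxm.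
have [[y [y0 lyx]]|H] := classic (exists y, y != 0 /\ (rk y < rk x)%N).
  by apply: (IH y) => //; apply: leq_trans lxm.
exists x; split=> // y y0; rewrite leqNgt; apply/negP => lyx.
by apply: H; exists y.
Qed.

(* [phi (x * w)] and [phi x] have the same rank, hence the same column space. *)
Lemma min_rank_cancel (x u w : A) : min_rank x -> x * w != 0 -> u * (x * w) = 0 -> u * x = 0.
Proof.
move=> [x0 minx] xw0 uxw.
have sub : ((phi (x * w)%R)^T <= (phi x)^T)%MS by rewrite phiM trmx_mul submxMl.
have : ((phi x)^T <= (phi (x * w)%R)^T)%MS.
  by rewrite -(geq_leqif (mxrank_leqif_sup sub)) !mxrank_tr minx.
case/submxP => D /(congr1 trmx); rewrite trmx_mul !trmxK => ex.
by apply: rep_inj0; rewrite phiM ex mulmxA -phiM uxw phi0 mul0mx.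
Qed.

(** If every such product vanished, linearity would give phi(x) G phi(x) = 0 for all matrices G,
    which fails for the pseudo-inverse. *)
Lemma prime_witness (x : A) : x != 0 -> exists y : A, x * y * x != 0.
Proof.
move=> x0; apply: NNPP => H.
suff : phi x *m pinvmx (phi x) *m phi x = 0.
  by rewrite mulmxKpV // => /rep_inj0 /eqP; rewrite (negPf x0).
apply: (rep_span_ind (P := fun G => phi x *m G *m phi x = 0)) => [y|c G1 G2 e1 e2].
  rewrite -!phiM; have [->|xyx] := eqVneq (x * y * x) 0; first exact: phi0.
  by case: H; exists y.
by rewrite mulmxDr -scalemxAr mulmxDl -scalemxAl e1 e2 scaler0 addr0.
Qed.

Lemma finite_min_rank_idempotent (l : seq A) : (forall x, x \in l) ->
  exists u : A, min_rank u /\ u * u = u.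
Proof.
move=> lP; have [x minx] := min_rank_exists.
have [y xyx0] := prime_witness minx.1.
(* No power of [x * y] vanishes: since [x * (y * x)] is nonzero, that factor can be cancelled down
   to [x] by minimality of rank. *)
have zkx k : (x * y) ^+ k * x != 0.
  elim: k => [|k IH]; first by rewrite mul1r minx.1.
  apply: contraNneq IH; rewrite exprSr -!mulrA => zx.
  apply/eqP; apply: (min_rank_cancel (w := y * x) minx) zx.
  by rewrite mulrA.
have [m em] := pow_idempotent (x * y) lP.
exists ((x * y) ^+ m.+1); split=> //; split.
  by apply: contraNneq (zkx m.+1) => ->; rewrite mul0r.
move=> w w0; apply: leq_trans (minx.2 w w0).
by rewrite /rk exprS -mulrA phiM mxrankM_maxl.
Qed.

(** The corner u A u is a ring with identity [u]. If x y = 0 there with y nonzero, then x (u y) = 0,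
    and cancellation against [u] gives x u = x = 0; a finite domain is commutative. *)
Lemma finite_corner_mulrC (s : seq F) (u : A) : (forall c, c \in s) ->
  min_rank u -> u * u = u ->
  forall x y : A, u * x * u * (u * y * u) = u * y * u * (u * x * u).
Proof.
move=> sP minu uu; pose f := (amulr u \o amull u)%VF.
have fE x : f x = u * x * u by rewrite !lfunE /= !lfunE.
pose U := limg f.
have memU x : x \in U -> u * x = x /\ x * u = x.
  by case/memv_imgP => y _ ->; rewrite fE -!mulrA uu !mulrA uu.
have inU x : u * x * u \in U by rewrite -fE memv_img ?memvf.
have asU : is_aspace U.
  apply/andP; split.
    apply/has_algidP; exists u; split; last exact: memU.
      by have := inU u; rewrite !uu.
    exact: minu.1.
  apply/prodvP => x y /memU [ux _] /memU [_ yu].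
  by have := inU (x * y); rewrite mulrA ux -mulrA yu.
pose US := ASpace asU.
have [l lP] := finite_vect_enumeration (subvs_of US) sP.
have domU : GRing.integral_domain_axiom (subvs_of US).
  move=> x y /(congr1 val) /= xy0; apply/orP; rewrite -!(inj_eq val_inj) /=.
  have [ux xu] := memU _ (valP x); have [uy yu] := memU _ (valP y).
  have [y0|y0] := eqVneq (val y) 0; [by right; apply/eqP | left].
  rewrite -xu; apply/eqP; apply: (min_rank_cancel (w := val y) minu).
    by rewrite uy.
  by rewrite uy.
move=> x y; have := enumerated_domain_mulrC lP domU (Subvs (inU x)) (Subvs (inU y)).
by move/(congr1 val).
Qed.

Lemma finite_rank1_idempotent (s : seq F) : (forall c, c \in s) ->
  exists (u : A) (p : 'cV[L]_n) (q : 'rV[L]_n),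
    [/\ u * u = u, phi u = p *m q & q *m p = 1%:M].
Proof.
move=> sP; have [l lP] := finite_vect_enumeration A sP.
have [u [minu uu]] := finite_min_rank_idempotent lP.
have com := finite_corner_mulrC sP minu uu.
have EE : phi u *m phi u = phi u by rewrite -phiM uu.
(* Commutation is linear in each of [Y] and [Z], so it passes from [A] to all matrices over [L]. *)
have comE Y Z : phi u *m Y *m phi u *m Z *m phi u = phi u *m Z *m phi u *m Y *m phi u.
  elim/rep_span_ind: Y => [y|c Y1 Y2 e1 e2].
    elim/rep_span_ind: Z => [z|c Z1 Z2 e1 e2].
      by rewrite -!phiM; move: (com y z); rewrite !mulrA -!(mulrA _ u u) uu => ->.
    by rewrite !(mulmxDr, mulmxDl) -!(scalemxAr, scalemxAl) e1 e2.
  by rewrite !(mulmxDr, mulmxDl) -!(scalemxAr, scalemxAl) e1 e2.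
have E0 : phi u != 0 by apply: contraNneq minu.1 => /rep_inj0 ->.
by have [p [q [epq eqp]]] := commuting_corner_rank1 E0 EE comE; exists u, p, q.
Qed.

Lemma finite_signed_intertwiner (s : seq F) a :
  (forall x y : A, th (x * y) = th y * th x) ->
  (forall c, c \in s) -> has_signed_intertwiner a.
Proof.
move=> thM sP; have [u [p [q [uu eu qp]]]] := finite_rank1_idempotent sP.
pose W := limg (amulr u); pose k := \dim W; pose w := vbasis W.
have WP x : x * u \in W by rewrite -[x * u](lfunE (u \o* idfun)) memv_img ?memvf.
have wu (i : 'I_k) : w`_i * u = w`_i.
  have : w`_i \in W by rewrite vbasis_mem // mem_nth // size_tuple.
  by case/memv_imgP => y _ ->; rewrite lfunE /= -mulrA uu.
have phiw (i : 'I_k) : phi w`_i = phi w`_i *m p *m q by rewrite -{1}wu phiM eu mulmxA.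
(* The columns of [P] turn out to be an [L]-basis of the column space, in which phi(a) becomes the
   matrix [M] over [F] of left multiplication by [a] on A u. *)
pose P := \matrix_(i < n, j < k) (phi w`_j *m p) i 0.
have colPE j : col j P = phi w`_j *m p.
  by apply/colP=> i; rewrite !mxE.
pose M := \matrix_(i < k, j < k) coord w i (a * w`_j).
have aP : phi a *m P = P *m map_mx iota M.
  apply/matrixP=> i j; have -> : (phi a *m P) i j = (phi (a * w`_j) *m p) i 0.
    by rewrite phiM -mulmxA -colPE colE mulmxA -colE [RHS]mxE.
  have -> : a * w`_j = \sum_l M l j *: w`_l.
    have /coord_vbasis {1}-> : a * w`_j \in W by rewrite -wu mulrA WP.
    by apply: eq_bigr => l _; rewrite mxE.
  rewrite phi_sum mulmx_suml summxE !mxE; apply: eq_bigr => l _.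
  by rewrite -scalemxAl !mxE mulrC.
have freeP : row_free P^T.
  apply: inj_row_free => c; rewrite -[c]trmxK -trmx_mul => /(congr1 trmx).
  rewrite trmxK trmx0 => Pc.
  have : \sum_i c 0 i *: phi w`_i = 0.
    under eq_bigr => i _ do rewrite phiw -colPE scalemxAl.
    rewrite -mulmx_suml; suff -> : \sum_i c 0 i *: col i P = 0 by rewrite mul0mx.
    rewrite -[RHS]Pc; apply/colP=> i; rewrite summxE !mxE.
    by apply: eq_bigr => j _; rewrite !mxE mulrC.
  by move/(rep_free (basis_free (vbasisP W))) => c0; apply/rowP=> i; rewrite c0 mxE.
have fullP : row_full P^T.
  rewrite -sub1mx; apply/row_subP => i.
  have H G : ((G *m p)^T <= P^T)%MS.
    elim/rep_span_ind: G => [x|c G1 G2 H1 H2]; last first.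
      by rewrite mulmxDl -scalemxAl linearP /= addmx_sub ?scalemx_sub.
    have -> : phi x *m p = phi (x * u) *m p.
      by rewrite phiM eu -!mulmxA qp mulmx1.
    rewrite (coord_vbasis (WP x)) phi_sum mulmx_suml linear_sum summx_sub // => j _.
    by rewrite -scalemxAl -colPE linearZ /= scalemx_sub // tr_col row_sub.
  (* Every column vector c is of the form G p, with G = c q. *)
  by have := H ((row i 1%:M)^T *m q); rewrite -mulmxA qp mulmx1 trmxK.
have [Q PQ] := row_freeP freeP.
have QP : Q *m P^T = 1%:M.
  have /row_fullP [Q' Q'P] := fullP.
  by rewrite -[Q]mul1mx -{1}Q'P -(mulmxA Q') PQ mulmx1 Q'P.
have [H [uH sH cH]] := sym_intertwiner M.
(* If this scalar vanished for all y, it would vanish for every matrix in place of phi(y), whereas p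
   p^T b^-1 gives 1. *)
have [y y0] : exists y, q *m phi y *m b *m q^T != 0.
  apply: NNPP => Hy.
  have : q *m (p *m p^T *m invmx b) *m b *m q^T = 0.
    apply: (rep_span_ind (P := fun G => q *m G *m b *m q^T = 0)) => [y|c G1 G2 e1 e2].
      by apply/eqP; rewrite -[_ == _]negbK; apply/negP => y0; apply: Hy; exists y.
    by rewrite !(mulmxDr, mulmxDl) -!(scalemxAr, scalemxAl) e1 e2 scaler0 addr0.
  rewrite !mulmxA qp mul1mx mulmxKV // -trmx_mul qp => /matrixP/(_ 0 0)/eqP.
  by rewrite !mxE oner_eq0.
pose ga := (q *m phi y *m b *m q^T) 0 0.
have ega : q *m phi y *m b *m q^T = ga%:M by apply: mx11_scalar.
have ga0 : ga != 0 by apply: contraNneq y0 => ga0; rewrite ega ga0 -scalemx1 scale0r.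
pose Hi := map_mx iota H.
have uHi : Hi \in unitmx by rewrite map_unitmx.
pose S := ga *: (P *m Hi *m P^T).
have sS : S^T = S.
  by rewrite /S linearZ /= !trmx_mul trmxK map_trmx sH mulmxA.
have uS : S \in unitmx.
  rewrite unitmxZ ?unitfE //.
  (* The sizes k and n are never identified, so an explicit inverse is built from the two-sided
     inverse [Q] of [P^T]. *)
  have : P *m Hi *m P^T *m (Q *m invmx Hi *m Q^T) = 1%:M.
    rewrite !mulmxA -(mulmxA _ _ Q) PQ mulmx1 mulmxK //.
    by rewrite -[P]trmxK -trmx_mul QP trmx1.
  by case/mulmx1_unit.
have cS : phi a *m S = S *m (phi a)^T.
  rewrite /S -scalemxAr -scalemxAl; congr (_ *: _).
  rewrite -[RHS]mulmxA -trmx_mul aP trmx_mul !mulmxA aP; congr (_ *m _).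
  by rewrite -!mulmxA map_trmx -!map_mxM cH.
pose g := \sum_(i < k) \sum_(j < k) H i j *: (w`_i * y * th w`_j).
have phig : phi g = S *m invmx b.
  have -> : g = \sum_i 1 *: (\sum_(j < k) H i j *: (w`_i * y * th w`_j)).
    by apply: eq_bigr => i _; rewrite scale1r.
  rewrite phi_sum; under eq_bigr => i _ do rewrite rmorph1 scale1r phi_sum.
  (* As phi(w_i) = P_i q, the middle factor q phi(y) b q^T collapses to the scalar [ga], which is
     why [S] carries it. *)
  have term (i j : 'I_k) : phi (w`_i * y * th w`_j) = ga *: (col i P *m (col j P)^T *m invmx b).
    have -> : phi (w`_i * y * th w`_j) =
        col i P *m (q *m phi y *m b *m q^T) *m (col j P)^T *m invmx b.
      by rewrite !phiM phi_th (phiw i) (phiw j) -!colPE !trmx_mul !mulmxA.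
    by rewrite ega mul_mx_scalar -!scalemxAl.
  have -> : S *m invmx b =
      \sum_i \sum_j iota (H i j) *: (ga *: (col i P *m (col j P)^T *m invmx b)).
    rewrite /S -scalemxAl.
    have -> : P *m Hi *m P^T = \sum_i \sum_j iota (H i j) *: (col i P *m (col j P)^T).
      apply/matrixP=> x z; rewrite exchange_big summxE mxE; apply: eq_bigr => j _.
      rewrite summxE !mxE mulr_suml; apply: eq_bigr => i _.
      by rewrite !mxE big_ord1 !mxE mulrCA mulrA.
    rewrite mulmx_suml scaler_sumr; apply: eq_bigr => i _.
    rewrite mulmx_suml scaler_sumr; apply: eq_bigr => j _.
    by rewrite -scalemxAl scalerA mulrC -scalerA.
  by apply: eq_bigr => i _; apply: eq_bigr => j _; rewrite term.
exists g; split.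
- by apply: rep_unit; rewrite phig unitmx_mul uS unitmx_inv.
- by apply: rep_inj; rewrite !phiM phi_th phig conj_div_intertwiner.
- by apply: rep_inj; rewrite phi_th phiZ phig conj_sym_div.
Qed.
End SplitRepresentation.

(** * The finite and infinite cases combined *)

Lemma enumerated_or_infinite (T : eqType) :
  (exists s : seq T, forall x, x \in s) \/
  (forall m, exists s : seq T, uniq s /\ size s = m).
Proof.
have [?|H] := classic (exists s : seq T, forall x, x \in s); [by left | right].
elim=> [|m [s [us szs]]]; first by exists [::].
have [x xs] : exists x, x \notin s.
  apply: NNPP => H1; apply: H; exists s => x.
  by apply/negPn/negP => xs; apply: H1; exists x.
by exists (x :: s); rewrite /= xs us szs.
Qed.

Unset Implicit Arguments.

Theorem mainTheorem1 (F : fieldType) (A : falgType F) (th : A -> A) (e : F) :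
  is_csa A -> is_involution th -> inv_sign th e ->
  forall a : A, exists g : A,
    [/\ g \is a GRing.unit, g * a * g^-1 = th a & th g = e *: g].
Proof.
move=> _ [thl thM thK].
case=> L [iota [n [phi [b [phil [phi1 [phiM [dimA [phif [ub [phith symb]]]]]]]]]]] a.
have [g [ug ag thg]] : has_signed_intertwiner th e (th a).
  have [[s sP]|infF] := enumerated_or_infinite F.
    by apply: finite_signed_intertwiner symb s _ _ sP.
  by apply: infinite_signed_intertwiner symb _ infF.
(* For [th a] the relation reads th(a) g = g th(th(a)) = g a. *)
by exists g; split=> //; rewrite -[X in g * X]thK -ag mulrK.
Qed.
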